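(* Suppose that the infinite-dimensional dynamic programming equation $$\inf_{\alpha\in K}\left\{\frac{\partial V(t,\tilde x)}{\partial t}+\sum_{i=1}^\infty\frac{\partial V(t,\tilde x)}{\partial\tilde x_i}\left[g_i(t,x_0(t)+\tilde x_1,\alpha)+\tilde x_{i+1}\right]+F(t,x_0(t)+\tilde x_1,\alpha)\right\}=0,\qquad V(T,\tilde x)=F_0(x_0(T)+\tilde x_1),$$ has a continuously differentiable solution, and let $(\lambda_1,\lambda_2,\dots)$ be the co-states of the infinite-dimensional ODE control problem, which satisfy the Hamiltonian system $$\frac{d\lambda_1(t)}{dt}+\sum_{i=1}^\infty\lambda_i(t)\left(\frac{\partial^{i}}{\partial t^{i-1}\partial x_1}f(t,s,x_0(s)+x_1(s),u(s))\right)\Big|_{s=t}+\frac{\partial}{\partial x_1}F(t,x_0(t)+x_1(t),u(t))=0,$$ $$\frac{d\lambda_j(t)}{dt}+\lambda_{j-1}(t)=0\ \ (j\ge2),\qquad \lambda_1(T)=\frac{\partial}{\partial x_1}F_0(x_0(T)+x_1(T)),\qquad \lambda_j(T)=0\ \ (j\ge2),$$ and suppose that this system possesses a unique solution. Let $\psi$ be the co-state of the original Volterra control problem, i.e. the solution of the adjoint integral equation $$\psi(t)=\frac{\partial}{\partial x_1}F(t,x_0(t)+x_1(t),u(t))+\left(\frac{\partial}{\partial x_1}F_0(x_0(T)+x_1(T))\right)\left(\frac{\partial}{\partial x_1}f(T,t,x_0(t)+x_1(t),u(t))\right)+\int_t^T\psi(s)\frac{\partial}{\partial x_1}f(s,t,x_0(t)+x_1(t),u(t))\,ds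 .$$ Define $\mu_1(t)=\int_t^T\psi(s)\,ds+\frac{\partial}{\partial x_1}F_0(x_0(t)+x_1(t))$ and $\mu_j(t)=\int_t^T\mu_{j-1}(s)\,ds$ for $j\ge2$, and suppose that $$\lim_{j\to\infty}\int_t^T\mu_j(s)\frac{\partial^{j+1}}{\partial s^j\partial x_1}f(s,t,x_0(t)+x_1(t),u(t))\,ds=0\quad\text{uniformly for }t\in[0,T]\text{ and }u(\cdot)\in U_{ad}.$$ Then the co-states of the infinite-dimensional ODE control problem are given by $$\lambda_j(t)=\int_t^T\left\{\frac{(s-t)^{j}}{j!}\,\psi(s)+\frac{(s-t)^{j-1}}{(j-1)!}\,\frac{\partial}{\partial x_1}F_0(x_0(s)+x_1(s))\right\}ds,$$ where, for $j=1$, $\lambda_1(T)$ is defined by continuity as $t\to T^-$, i.e. $\lambda_1(T)=\frac{\partial}{\partial x_1}F_0(x_0(T)+x_1(T))$; and, conversely, $$\psi(t)=(-1)^j\frac{d^j\lambda_j(t)}{dt^j}.$$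
   Context: $T>0$ is fixed; $x_0:[0,T]\to\mathbb{R}$ is a given function; $K$ is the set of control values; $U_{ad}$ is the class of admissible controls. The original problem is to minimize $J=\int_0^TF(t,x(t),u(t))\,dt+F_0(x(T))$ over $u(\cdot)\in U_{ad}$, subject to the Volterra integral equation $x(t)=x_0(t)+\int_0^tf(t,s,x(s),u(s))\,ds$, where $f,F,F_0$ are real-valued and differentiable as often as the expressions require. Writing $x=x_0+x_1$, with $$x_n(t)=\int_0^t\frac{\partial^{n-1}}{\partial t^{n-1}}f(t,s,x_0(s)+x_1(s),u(s))\,ds,\quad n\ge1,$$ the problem becomes that of minimizing $J$ subject to the infinite-dimensional ODE system (with state space $\ell^\infty$) $$\dot x_n(t)=g_n(t,x_0(t)+x_1(t),u(t))+x_{n+1}(t),\quad x_n(0)=0,\quad n=1,2,\dots,\qquad g_n(t,x,u)=\frac{\partial^{n-1}}{\partial t^{n-1}}f(t,s,x,u)\Big|_{s=t}.$$ $\frac{\partial}{\partial x_1}$ applied to $f$, $F$, $F_0$ at $x_0+x_1$ denotes the derivative in the state argument; $\frac{\partial^{k}}{\partial t^{k}}f(t,s,\cdot,\cdot)$ and $\frac{\partial^k}{\partial s^k}f(s,t,\cdot,\cdot)$ denote derivatives in the first argument of $f$. The co-states $\lambda_j$ of the ODE problem make up the space-gradient of the value function $V$ along the trajectory.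
   Formalization: F_0' is taken at x_0(T)+x_1(T), not at time t or s, in μ_1 and the λ formula; the printed integrand is that of λ_{j+1}, and λ_1(t)=∫_t^T ψ ds+F_0'(x_0(T)+x_1(T)); ψ=(-1)^j d^jλ_j/dt^j is claimed for a.e. t and at every t in (0,T) where ψ is continuous. *)

(* Defs.v *)
From HB Require Import structures.
From mathcomp Require Export all_boot all_order all_algebra.
From mathcomp Require Export all_classical all_reals all_analysis.
Export Order.TTheory GRing.Theory Num.Theory.
Export numFieldNormedType.Exports.

Set Implicit Arguments.
Unset Strict Implicit.
Unset Printing Implicit Defensive.

Local Open Scope classical_set_scope.
Local Open Scope ring_scope.

(* The Banach space l^oo: real sequences with finite sup norm. *)

Definition bounded_seq {R : realType} : {pred nat -> R} :=
  fun x => `[< exists M : R, forall i, `|x i| <= M >].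

Lemma bounded_seq_submod_closed {R : realType} : submod_closed (@bounded_seq R).
Proof.
split=> [|a x y /asboolP[M hM] /asboolP[N hN]]; apply/asboolP.
  by exists 0 => i; rewrite /= normr0.
exists (`|a| * M + N) => i /=.
rewrite (le_trans (ler_normD _ _))// lerD//.
by rewrite normrM ler_wpM2l.
Qed.

HB.instance Definition _ (R : realType) :=
  GRing.isSubmodClosed.Build R (nat -> R) (@bounded_seq R)
    (@bounded_seq_submod_closed R).

Record linf (R : realType) := Linf {
  linf_val :> nat -> R;
  _ : linf_val \in @bounded_seq R }.

Section linf_structure.
Context {R : realType}.

HB.instance Definition _ := [isSub for @linf_val R].
HB.instance Definition _ := [Choice of linf R by <:].
HB.instance Definition _ := [SubChoice_isSubLmodule of linf R by <:].

Implicit Types x y : linf R.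

Lemma linf_bounded x : exists M : R, forall i, `|x i| <= M.
Proof. by case: x => x /= /asboolP. Qed.

Definition linf_norm x : R := sup (range (fun i => `|x i|)).

Lemma linf_norm_ub x i : `|x i| <= linf_norm x.
Proof.
apply: ub_le_sup; last by exists i.
by have [M hM] := linf_bounded x; exists M => _ [k _ <-].
Qed.

Lemma linf_norm_le x M : (forall i, `|x i| <= M) -> linf_norm x <= M.
Proof.
move=> hM; apply: ge_sup; first by exists `|x 0%N|; exists 0%N.
by move=> _ [k _ <-].
Qed.

Lemma linf_normD x y : linf_norm (x + y) <= linf_norm x + linf_norm y.
Proof.
apply: linf_norm_le => i; rewrite (le_trans (ler_normD _ _))// lerD//;
  exact: linf_norm_ub.
Qed.

Lemma linf_normZ (l : R) x : linf_norm (l *: x) = `|l| * linf_norm x.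
Proof.
have le l' x' : linf_norm (l' *: x') <= `|l'| * linf_norm x'.
  apply: linf_norm_le => i /=.
  by rewrite [_ i]/(_ * _) normrM ler_wpM2l// linf_norm_ub.
apply/eqP; rewrite eq_le le /=.
have [->|l0] := eqVneq l 0.
  by rewrite normr0 mul0r; exact: le_trans (linf_norm_ub _ 0%N).
have := le l^-1 (l *: x).
rewrite scalerA mulVf// scale1r => /(ler_wpM2l (normr_ge0 l)).
by rewrite mulrA -normrM mulfV// normr1 mul1r.
Qed.

Lemma linf_norm_eq0 x : linf_norm x = 0 -> x = 0.
Proof.
move=> x0; apply: val_inj; apply/funext => i /=.
by apply/eqP; rewrite -normr_le0 -x0 linf_norm_ub.
Qed.

HB.instance Definition _ :=
  Lmodule_isNormed.Build R (linf R) linf_normD linf_normZ linf_norm_eq0.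

Lemma linf_basis_subproof (i : nat) :
  (fun k => (k == i)%:R : R) \in @bounded_seq R.
Proof.
by apply/asboolP; exists 1 => k; case: eqP => _; rewrite ?normr1 ?normr0.
Qed.

Definition linf_basis (i : nat) : linf R := Linf (linf_basis_subproof i).

End linf_structure.

Section Calculus.
Context {R : realType}.

Definition absolutely_continuous (a b : R) (g : R -> R) : Prop :=
  forall e : R, 0 < e -> exists2 d : R, 0 < d &
    forall (n : nat) (l r : nat -> R),
      (forall i, (i < n)%N -> [/\ a <= l i, l i <= r i & r i <= b]) ->
      (forall i j, (i < j)%N -> (j < n)%N -> r i <= l j) ->
      \sum_(i < n) (r i - l i) < d ->
      \sum_(i < n) `|g (r i) - g (l i)| < e.

(* [derive1n n g] is a total function: the first conjunct makes it meaningful at t. *)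
Definition is_nth_derive (n : nat) (g : R -> R) (t l : R) : Prop :=
  (forall k, (k < n)%N -> derivable (derive1n k g) t 1) /\ derive1n n g t = l.

Context {U : Type}.
Implicit Types f : R -> R -> R -> U -> R.

(* In f t s y a, the arguments t and s are the two times of the Volterra
   kernel, y is the state and a the control value. *)
Definition dstate f : R -> R -> R -> U -> R :=
  fun t s y a => derive1 (fun z => f t s z a) y.

Definition dtime (n : nat) f : R -> R -> R -> U -> R :=
  fun t s y a => derive1n n (fun r => f r s y a) t.

End Calculus.

(* All families indexed by 1, 2, ... in the mathematics are indexed by nat,
   starting at 0: for x, g, mu and the co-states lambda, index i stands for the
   mathematical index i + 1. *)
Section VolterraControl.
Context {R : realType} {U : Type}.
Variables (T : R) (x0 : R -> R) (K : set U) (Uad : set (R -> U)).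
Variables (f : R -> R -> R -> U -> R) (F : R -> R -> U -> R) (F0 : R -> R).

Local Notation mu := (@lebesgue_measure R).

(* Existence of exactly those partial derivatives of the data that occur below. *)
Definition smooth_data : Prop :=
  [/\ forall n (t s y : R) a, 0 <= t <= T -> 0 <= s <= T -> K a ->
        [/\ derivable (derive1n n (fun r => f r s y a)) t 1,
            derivable (fun z => f t s z a) y 1 &
            derivable (derive1n n (fun r => dstate f r s y a)) t 1],
      forall (t y : R) a, 0 <= t <= T -> K a -> derivable (fun z => F t z a) y 1 &
      forall y, derivable F0 y 1].

(* The trajectory (x_1, x_2, ...) in l^oo generated by the control u. *)
Definition is_trajectory (u : R -> U) (x : R -> linf R) : Prop :=
  forall t : R, 0 <= t <= T -> forall n,
    let h s := dtime n f t s (x0 s + x s 0%N) (u s) in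
    mu.-integrable `[0, t] (EFin \o h) /\ x t n = \int[mu]_(s in `[0, t]) h s.

Definition state (x : R -> linf R) (t : R) : R := x0 t + x t 0%N.

Definition dtV (V : R * linf R -> R) (t : R) (z : linf R) : R :=
  'D_((1, 0) : R * linf R) V (t, z).

Definition dxV (V : R * linf R -> R) (i : nat) (t : R) (z : linf R) : R :=
  'D_((0, linf_basis i) : R * linf R) V (t, z).

(* Frechet C^1 on [0, T] x l^oo, the differential being continuous in the
   operator norm. *)
Definition continuously_differentiable (V : R * linf R -> R) : Prop :=
  let D := [set p : R * linf R | 0 <= p.1 <= T] in
  (forall p, D p -> differentiable V p) /\
  forall p, D p -> forall e : R, 0 < e -> \forall q \near p, D q ->
    forall h, `|'d V q h - 'd V p h| <= e * `|h|.

Definition hjb_terms V (t : R) (z : linf R) (a : U) : nat -> R :=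
  fun i => dxV V i t z * (dtime i f t t (x0 t + z 0%N) a + z i.+1).

Definition hjb_expr V (t : R) (z : linf R) (a : U) : R :=
  dtV V t z + limn (series (hjb_terms V t z a)) + F t (x0 t + z 0%N) a.

Definition hjb_solution (V : R * linf R -> R) : Prop :=
  [/\ continuously_differentiable V,
      forall (t : R) z, 0 <= t <= T ->
        (forall a, K a -> cvgn (series (hjb_terms V t z a))) /\
        ereal_inf [set (hjb_expr V t z a)%:E | a in K] = 0%E &
      forall z, V (T, z) = F0 (x0 T + z 0%N)].

(* The controls are not assumed continuous, so the differential equations are
   understood in the sense of Caratheodory. *)
Definition hamiltonian_solution (u : R -> U) (x : R -> linf R)
    (lam : nat -> R -> R) : Prop :=
  let terms t := fun i => lam i t * dtime i (dstate f) t t (state x t) (u t) in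
  [/\ forall j, absolutely_continuous 0 T (lam j),
      forall t : R, 0 <= t <= T -> cvgn (series (terms t)),
      {ae mu, forall t : R, 0 <= t <= T ->
        is_derive t (1 : R) (lam 0%N)
          (- (limn (series (terms t)) + derive1 (fun z => F t z (u t)) (state x t)))},
      forall j, {ae mu, forall t : R, 0 <= t <= T ->
        is_derive t (1 : R) (lam j.+1) (- lam j t)} &
      lam 0%N T = derive1 F0 (state x T) /\ forall j, lam j.+1 T = 0].

Definition is_adjoint (u : R -> U) (x : R -> linf R) (psi : R -> R) : Prop :=
  mu.-integrable `[0, T] (EFin \o psi) /\
  forall t : R, 0 <= t <= T ->
    psi t = derive1 (fun z => F t z (u t)) (state x t)
          + derive1 F0 (state x T) * dstate f T t (state x t) (u t)
          + \int[mu]_(s in `[t, T]) (psi s * dstate f s t (state x t) (u t)).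

(* The terminal-cost term is the constant F0'(x(T)), as the terminal condition
   on lambda_1 and the equation (d/dt) mu_1 = - psi require. *)
Fixpoint iterated_psi (x : R -> linf R) (psi : R -> R) (j : nat) : R -> R :=
  match j with
  | 0%N => fun t => \int[mu]_(s in `[t, T]) psi s + derive1 F0 (state x T)
  | i.+1 => fun t => \int[mu]_(s in `[t, T]) iterated_psi x psi i s
  end.

(* The time derivative of order j + 1 goes with mathematical index j + 1. *)
Definition remainder (u : R -> U) (x : R -> linf R) (psi : R -> R) (j : nat)
    (t : R) : R :=
  \int[mu]_(s in `[t, T])
    (iterated_psi x psi j s * dtime j.+1 (dstate f) s t (state x t) (u t)).

Definition remainders_vanish (X : (R -> U) -> R -> linf R)
    (psi : (R -> U) -> R -> R) : Prop :=
  forall e : R, 0 < e -> \forall j \near \oo,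
    forall u (t : R), Uad u -> 0 <= t <= T -> `|remainder u (X u) (psi u) j t| <= e.

End VolterraControl.

(* Main.v *)
(* Integrating by parts repeatedly in the adjoint equation, with the iterated
   tail integrals mu_1, mu_2, ... of psi and k(s) = d/dx f(s, t, x(t), u(t)),
   gives
     psi(t) = d/dx F + mu_1(t) k(t) + ... + mu_n(t) k^(n-1)(t)
              + int_t^T mu_n(s) k^(n)(s) ds.
   The remainders vanish by hypothesis, so (d/dt) mu_1 = - psi turns into the
   first Hamiltonian equation; the others are the definition of the mu_j.
   Uniqueness identifies lambda_j with mu_j, and the closed formula follows by
   integrating by parts against the powers (s - t)^n / n!. *)
Require Import Defs.
From mathcomp Require Import measurable_realfun ring.

Set Implicit Arguments.
Unset Strict Implicit.
Unset Printing Implicit Defensive.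

Local Open Scope classical_set_scope.
Local Open Scope ring_scope.

Lemma is_derive_derive1 {R : realType} (P : R -> R) (t l : R) :
  derivable P t 1 /\ derive1 P t = l -> is_derive t (1 : R) P l.
Proof. by move=> [dP <-]; rewrite derive1E; exact: derivableP. Qed.

(** * Tail integrals: absolute continuity, differentiation, integration by parts *)

Section TailIntegral.
Context {R : realType}.
Local Notation mu := (@lebesgue_measure R).
Implicit Types (a b t : R) (h g k : R -> R).

Definition tail_integral b h t : R := \int[mu]_(s in `[t, b]) h s.

Lemma integrable_subitv a b l r h : a <= l -> r <= b ->
  mu.-integrable `[a, b] (EFin \o h) -> mu.-integrable `[l, r] (EFin \o h).
Proof.
move=> al rb; apply: integrableS => //.
by apply: subset_itvScc; rewrite bnd_simp.
Qed.

Lemma integrable_patchT a b h : mu.-integrable `[a, b] (EFin \o h) ->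
  mu.-integrable setT (EFin \o (h \_ `[a, b])).
Proof.
by move=> hi; rewrite -restrict_EFin; apply/integrable_restrict; rewrite ?setTI.
Qed.

Lemma tail_integralE a b t h : mu.-integrable `[a, b] (EFin \o h) ->
  a <= t <= b ->
  tail_integral b h t = tail_integral b h a - \int[mu]_(s in `[a, t]) h s.
Proof.
move=> hi /andP[at_ tb]; rewrite /tail_integral Rintegral_itvB ?bnd_simp//.
rewrite Rintegral_itv_obnd_cbnd//.
apply: integrableS (integrable_subitv at_ (lexx b) hi) => //.
exact: subset_itv_oc_cc.
Qed.

Lemma tail_integral_end b h : tail_integral b h b = 0.
Proof. by rewrite /tail_integral set_itv1 Rintegral_set1. Qed.

Lemma tail_integral_continuous a b h : a <= b ->
  mu.-integrable `[a, b] (EFin \o h) ->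
  {within `[a, b], continuous (tail_integral b h)}.
Proof.
move=> ab hi.
have := parameterized_integral_continuous ab hi => cP.
apply: (@subspace_eq_continuous _ _ _
  (fun t => tail_integral b h a - parameterized_integral mu a t h)).
  by move=> t; rewrite inE/= in_itv/= => tab; rewrite [RHS](tail_integralE hi tab).
by move=> t; apply: cvgB; [exact: cvg_cst|exact: cP].
Qed.

(** Increments of the tail integral are, up to sign, integrals of [h] over the small intervals, and
    the integral of [|h|] over a set of small measure is small. *)
Lemma absolutely_continuous_tail_integral a b h :
  mu.-integrable `[a, b] (EFin \o h) ->
  absolutely_continuous a b (tail_integral b h).
Proof.
move=> hi e e0; pose hab : R -> R := h \_ `[a, b].
have habi : mu.-integrable setT (EFin \o hab) by exact: integrable_patchT.
have [d [d0 small]] := integral_normr_continuous habi e0.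
exists d => // n l r lr rl sumd.
(* Half-open intervals stay disjoint when one ends where another begins. *)
pose I (i : 'I_n) := `]l i, r i]%classic : set (measurableTypeR R).
have mI i : measurable (I i) by exact: measurable_itv.
have tI : trivIset setT I.
  move=> i j _ _ [x []]; rewrite /I/= !in_itv/= => /andP[lx xr] /andP[lx' xr'].
  apply: val_inj => /=; case: (ltngtP i j) => // ij.
  - by have := rl _ _ ij (ltn_ord j); rewrite leNgt (lt_le_trans lx' xr).
  - by have := rl _ _ ij (ltn_ord i); rewrite leNgt (lt_le_trans lx xr').
have mUI : measurable (\big[setU/set0]_(i < n) I i) by exact: bigsetU_measurable.
have habnI : mu.-integrable setT (fun x => `|hab x|%:E) by exact: integrable_abse habi.
have muI : (mu (\big[setU/set0]_(i < n) I i) < d%:E)%E.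
  rewrite measure_semi_additive_ord//.
  rewrite (eq_bigr (fun i : 'I_n => (r i - l i)%:E)) ?sumEFin ?lte_fin// => i _.
  have [_ lri _] := lr i (ltn_ord i).
  rewrite [LHS](lebesgue_measure_itv `]l i, r i])/= lte_fin; case: ltP => // rli.
  by rewrite (@le_anti _ _ (l i) (r i)) ?lri ?rli// subrr.
apply: le_lt_trans (small _ mUI muI).
rewrite -lee_fin /Rintegral fineK; last first.
  by apply: integrable_fin_num => //; exact: integrableS habnI.
rewrite ge0_integral_bigsetU//; last 3 first.
  - exact: index_enum_uniq.
  - by move=> i j _ _; exact: tI.
  - apply: (@measurable_funS _ _ _ _ setT) => //.
    by have /integrableP[] := habnI.
rewrite -sumEFin; apply: lee_sum => i _.
have [ali lri rib] := lr i (ltn_ord i).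
have hili := integrable_subitv ali (lexx b) hi.
rewrite (@tail_integralE (l i) b (r i))//; last by rewrite lri.
rewrite addrAC subrr sub0r normrN.
have hilr := integrable_subitv ali rib hi.
have hilr' : mu.-integrable `]l i, r i] (EFin \o h).
  by apply: integrableS hilr => //; exact: subset_itv_oc_cc.
rewrite -(Rintegral_itv_obnd_cbnd hilr').
rewrite (_ : (\int[mu]_(x in I i) `|hab x|%:E)%E = (\int[mu]_(x in `]l i, r i]) `|h x|)%:E).
  by rewrite lee_fin; exact: le_normr_Rintegral.
rewrite /Rintegral fineK; last first.
  by apply: integrable_fin_num => //; exact: integrable_abse hilr'.
apply: eq_integral => x; rewrite inE /I/= in_itv/= => /andP[lx xr].
by rewrite /hab patchE mem_set//= in_itv/= (le_trans ali (ltW lx)) (le_trans xr rib).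
Qed.

(** Near an interior point the tail integral is a constant minus the indefinite integral from [a].
    The hypothesis on [P] has the shape in which the first fundamental theorem delivers its
    conclusion, at a continuity point or at a Lebesgue point. *)
Lemma is_derive_tail_integral_of_indefinite a b t h :
  mu.-integrable `[a, b] (EFin \o h) -> a < t < b ->
  let P s := \int[mu]_(r in `[a, s]) h r in
  derivable P t 1 /\ derive1 P t = h t ->
  is_derive t (1 : R) (tail_integral b h) (- h t).
Proof.
move=> hi /andP[at_ tb] P /is_derive_derive1 dP.
apply: (@near_eq_is_derive _ _ _ (fun s => tail_integral b h a - P s)).
  near=> s; rewrite (@tail_integralE a b s)//; apply/andP; split; apply: ltW.
  - by near: s; exact: lt_nbhsr.
  - by near: s; exact: lt_nbhsl.
rewrite -(sub0r (h t)); exact: is_deriveB.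
Unshelve. all: by end_near. Qed.

Lemma is_derive_tail_integral a b t h :
  mu.-integrable `[a, b] (EFin \o h) -> a < t < b -> {for t, continuous h} ->
  is_derive t (1 : R) (tail_integral b h) (- h t).
Proof.
move=> hi atb ct; apply: is_derive_tail_integral_of_indefinite (hi) (atb) _.
have /andP[at_ tb] := atb.
exact: (continuous_FTC1_closed tb hi at_ ct).
Qed.

Lemma ae_is_derive_tail_integral a b h :
  mu.-integrable `[a, b] (EFin \o h) ->
  {ae mu, forall t : R, a < t < b -> is_derive t (1 : R) (tail_integral b h) (- h t)}.
Proof.
move=> hi; pose hab := h \_ `[a, b].
have hab_eq t : t \in `[a, b] -> hab t = h t by move=> tab; rewrite /hab patchE mem_set.
have habi : mu.-integrable `[a, b] (EFin \o hab).
  by apply: eq_integrable hi => // t; rewrite inE/= => tab; rewrite /= hab_eq.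
(* This gives Lebesgue points of the zero extension [hab]. The derivative is computed for [hab] and
   carried back to [h], since the two tail integrals agree near an interior point. *)
have := lebesgue_differentiation (integrable_locally (measurable_itv `[a, b]) hi).
rewrite -/hab.
apply: filterS; first exact: (ae_filter_ringOfSetsType mu).
move=> t ht tab; have /andP[at_ tb] := tab.
rewrite -hab_eq; last by rewrite in_itv/= !ltW.
apply: (@near_eq_is_derive _ _ _ (tail_integral b hab)); last first.
  apply: is_derive_tail_integral_of_indefinite (habi) (tab) _.
  have /= := @FTC1_lebesgue_pt R hab (BLeft a) t b tb habi.
  by apply; rewrite ?lte_fin.
near=> s; apply: eq_Rintegral => r; rewrite inE/= in_itv/= => /andP[sr rb].
rewrite hab_eq// in_itv/= rb andbT (le_trans _ sr)// ltW//.
by near: s; exact: lt_nbhsr.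
Unshelve. all: by end_near. Qed.

Lemma integrable_mul_continuous a b h k :
  mu.-integrable `[a, b] (EFin \o h) -> {within `[a, b], continuous k} ->
  mu.-integrable `[a, b] (EFin \o (fun s => h s * k s)).
Proof.
move=> hi ck.
have bk : [bounded k x | x in `[a, b]].
  have /compact_bounded[M [Mr kM]] :=
    continuous_compact ck (@segment_compact R a b).
  exists M; split => // N MN x xab; apply: (kM N MN).
  by exists x.
have mk : measurable_fun `[a, b] k by exact: subspace_continuous_measurable_fun.
have := @integrableMr _ (measurableTypeR R) R mu _ (measurable_itv _) k _ mk bk hi.
by apply: eq_integrable => // s _ /=; rewrite mulrC EFinM.
Qed.

Lemma EFin_Rintegral_mkcond a b h : mu.-integrable `[a, b] (EFin \o h) ->
  (\int[mu]_s ((h \_ `[a, b]) s)%:E)%E = (\int[mu]_(s in `[a, b]) h s)%:E.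
Proof.
move=> hi; rewrite /Rintegral fineK; last exact: integrable_fin_num.
by rewrite [RHS]integral_mkcond/= restrict_EFin.
Qed.

(* Both sides are the double integral of h s * g r over a <= r <= s <= b. *)
Lemma Rintegral_tail_exchange a b h g :
  mu.-integrable `[a, b] (EFin \o h) -> mu.-integrable `[a, b] (EFin \o g) ->
  \int[mu]_(s in `[a, b]) (h s * \int[mu]_(r in `[a, s]) g r) =
  \int[mu]_(r in `[a, b]) (tail_integral b h r * g r).
Proof.
move=> hi gi; pose H : R -> R := h \_ `[a, b]; pose G : R -> R := g \_ `[a, b].
have Hi : mu.-integrable setT (EFin \o H).
  exact: integrable_patchT.
have Gi : mu.-integrable setT (EFin \o G).
  exact: integrable_patchT.
have mH : measurable_fun setT H by apply/measurable_EFinP; case/integrableP : Hi.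
have mG : measurable_fun setT G by apply/measurable_EFinP; case/integrableP : Gi.
have mnG : measurable_fun setT (fun x : measurableTypeR R => `|G x|%:E).
  by case/integrableP : (integrable_abse Gi).
have mnH : measurable_fun setT (fun x : measurableTypeR R => `|H x|%:E).
  by case/integrableP : (integrable_abse Hi).
(* Here [p.1] is r and [p.2] is s. The zero extensions [G] and [H] enforce the bounds [a] and [b],
   so the test [p.1 <= p.2] alone cuts out the triangle. *)
pose f (p : measurableTypeR R * measurableTypeR R) : \bar R :=
  (if p.1 <= p.2 then G p.1 * H p.2 else 0)%:E.
have mf : measurable_fun setT f.
  apply/measurable_EFinP; apply: measurable_fun_ifT => //.
  - exact: measurable_fun_ler measurable_fst measurable_snd.
  - apply: measurable_funM.
    + exact: measurableT_comp mG measurable_fst.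
    + exact: measurableT_comp mH measurable_snd.
have mf' : measurable_fun setT (abse \o f) by exact: measurableT_comp mf.
have If : (mu \x mu)%E.-integrable setT f.
  (* By Tonelli it suffices that the iterated integral of [|f|] is finite; it is dominated by the
     product of the L1 norms of [G] and [H]. *)
  apply/(integrable12ltyP _ _ mf).
  apply: (@le_lt_trans _ _ (\int[mu]_x (`|G x|%:E * \int[mu]_y `|H y|%:E))%E).
    apply: ge0_le_integral => //=.
    - by move=> x _; exact: integral_ge0.
    - by apply: (@measurable_fun_fubini_tonelli_F _ _ _ _ R mu _ mf') => p; exact: abse_ge0.
    - exact: emeasurable_funM.
    - move=> x _; rewrite -ge0_integralZl//.
      apply: ge0_le_integral => //=.
      + exact: measurableT_comp mf' (pair1_measurable x).
      + exact: measurable_funeM.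
      + move=> y _; rewrite -EFinM lee_fin /f/=.
        by case: ifP => _; rewrite ?normr0 ?mulr_ge0// normrM.
  have [C0 HC] : (0 <= \int[mu]_y `|H y|%:E)%E /\ (\int[mu]_y `|H y|%:E < +oo)%E.
    by split; [apply: integral_ge0 => y _; rewrite lee_fin|have /integrableP[] := Hi].
  have /integrableP[_ GC] := Gi.
  rewrite -(@fineK _ (\int[mu]_y `|H y|%:E)%E); last by rewrite ge0_fin_numE.
  rewrite ge0_integralZr//=.
  - rewrite lte_mul_pinfty ?ltry//; first by apply: integral_ge0 => y _; rewrite lee_fin.
    by rewrite ge0_fin_numE//; apply: integral_ge0 => y _; rewrite lee_fin.
  - by rewrite lee_fin fine_ge0.
have f1 r : (\int[mu]_s f (r, s) = (G r * tail_integral b h r)%:E)%E.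
  rewrite /f/=; have [|rab] := boolP (r \in `[a, b]); last first.
    have -> : G r = 0 by rewrite /G patchE memNset//; exact/negP.
    by rewrite mul0r integral0_eq// => s _; rewrite mul0r if_same.
  rewrite in_itv/= => /andP[ar rb].
  have hr : mu.-integrable `[r, b] (EFin \o h) by exact: integrable_subitv hi.
  rewrite EFinM -EFin_Rintegral_mkcond// -integralZl//; last first.
    exact: integrable_patchT.
  apply: eq_integral => s _; rewrite -EFinM; congr EFin; rewrite /H !patchE.
  rewrite !mem_setE !in_itv/=.
  case: (leP r s) => rs; last by rewrite mulr0.
  by rewrite (le_trans ar rs).
have f2 s : (\int[mu]_r f (r, s) = (H s * \int[mu]_(r in `[a, s]) g r)%:E)%E.
  rewrite /f/=; have [|sab] := boolP (s \in `[a, b]); last first.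
    have -> : H s = 0 by rewrite /H patchE memNset//; exact/negP.
    by rewrite mul0r integral0_eq// => r _; rewrite mulr0 if_same.
  rewrite in_itv/= => /andP[as_ sb].
  have gs : mu.-integrable `[a, s] (EFin \o g) by exact: integrable_subitv gi.
  rewrite EFinM -EFin_Rintegral_mkcond// -integralZl//; last first.
    exact: integrable_patchT.
  apply: eq_integral => r _; rewrite -EFinM; congr EFin; rewrite /G !patchE.
  rewrite !mem_setE !in_itv/= mulrC.
  case: (leP r s) => rs; last by rewrite andbF mulr0.
  by rewrite (le_trans rs sb).
have := Fubini If.
under eq_integral do rewrite f1.
under [RHS]eq_integral do rewrite f2.
move=> E; rewrite Rintegral_mkcond [RHS]Rintegral_mkcond; congr fine.
rewrite -[LHS](_ : (\int[mu]_s (H s * \int[mu]_(r in `[a, s]) g r)%:E)%E = _); last first.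
  apply: eq_integral => s _; congr EFin; rewrite /H !patchE; case: ifP => //.
  by rewrite mul0r.
rewrite -E; apply: eq_integral => s _; congr EFin; rewrite /G !patchE; case: ifP => //.
  by rewrite mulrC.
by rewrite mul0r.
Qed.

Lemma Rintegral_derive1 a b k : a <= b ->
  (forall s, a <= s <= b -> derivable k s 1) ->
  {within `[a, b], continuous (derive1 k)} ->
  \int[mu]_(s in `[a, b]) derive1 k s = k b - k a.
Proof.
rewrite le_eqVlt => /predU1P[<- _ _|ab dk ck].
  by rewrite set_itv1 Rintegral_set1 subrr.
have kc s : a <= s <= b -> k x @[x --> s] --> k s.
  by move=> /dk /derivable1_diffP /differentiable_continuous.
rewrite /Rintegral (@continuous_FTC2 _ _ k)// -?EFinB//.
split.
- by move=> s; rewrite in_itv/= => /andP[as_ sb]; apply: dk; rewrite !ltW.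
- by apply: cvg_at_right_filter; apply: kc; rewrite lexx ltW.
- by apply: cvg_at_left_filter; apply: kc; rewrite lexx ltW.
Qed.

(** With [k s] written as [k a] plus the integral of [k'] from [a] to [s], the constant gives the
    boundary term and the exchange of integrals gives the rest. Thus [h] need only be integrable,
    and the tail integral is never differentiated. *)
Lemma tail_integral_by_parts a b h k : a <= b ->
  mu.-integrable `[a, b] (EFin \o h) ->
  (forall s, a <= s <= b -> derivable k s 1) ->
  {within `[a, b], continuous (derive1 k)} ->
  \int[mu]_(s in `[a, b]) (h s * k s) =
  tail_integral b h a * k a +
  \int[mu]_(s in `[a, b]) (tail_integral b h s * derive1 k s).
Proof.
move=> ab hi dk ck.
have ki : mu.-integrable `[a, b] (EFin \o derive1 k).
  by apply: continuous_compact_integrable => //; exact: segment_compact.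
rewrite -Rintegral_tail_exchange// /tail_integral -RintegralZr// -RintegralD//.
- apply: eq_Rintegral => s; rewrite inE/= in_itv/= => /andP[as_ sb].
  rewrite Rintegral_derive1 ?mulrBr ?subrKC//.
  + by move=> r /andP[ar rs]; apply: dk; rewrite ar (le_trans rs).
  + by apply: continuous_subspaceW ck; apply: subset_itvl; rewrite bnd_simp.
- by apply: integrable_mul_continuous hi _ => x; exact: cvg_cst.
- apply: integrable_mul_continuous hi _.
  exact: parameterized_integral_continuous ab ki.
Qed.

End TailIntegral.

(** * The iterated tail integrals of [psi]: regularity, derivatives, expansion *)

Section IteratedPsi.
Context {R : realType}.
Variables (T : R) (x0 F0 : R -> R) (x : R -> linf R) (psi : R -> R).
Hypotheses (T_gt0 : 0 < T)
  (psi_int : (@lebesgue_measure R).-integrable `[0, T] (EFin \o psi)).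
Local Notation mu := (@lebesgue_measure R).
Implicit Types (t s : R) (i j n : nat).
Local Notation m := (iterated_psi T x0 F0 x psi).
Let c := derive1 F0 (state x0 x T).

Lemma iterated_psi_continuous j : {within `[0, T], continuous (m j)}.
Proof.
elim: j => [|j IH] /=.
  by move=> t; apply: cvgD; [exact: tail_integral_continuous (ltW _) _ t|exact: cvg_cst].
apply: tail_integral_continuous (ltW _) _ => //.
by apply: continuous_compact_integrable => //; exact: segment_compact.
Qed.

Lemma iterated_psi_integrable j : mu.-integrable `[0, T] (EFin \o m j).
Proof.
apply: continuous_compact_integrable; first exact: segment_compact.
exact: iterated_psi_continuous.
Qed.

Lemma absolutely_continuous_iterated_psi j : absolutely_continuous 0 T (m j).
Proof.
case: j => [|j] /=; last exact: absolutely_continuous_tail_integral (iterated_psi_integrable j).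
move=> e /(absolutely_continuous_tail_integral psi_int)[d d0 dP].
exists d => // n l r lr rl /(dP n l r lr rl); apply: le_lt_trans.
by apply: ler_sum => i _; rewrite opprD addrACA subrr addr0.
Qed.

Lemma iterated_psi0_end : m 0 T = c.
Proof. by rewrite /= set_itv1 Rintegral_set1 add0r. Qed.

Lemma iterated_psiS_end j : m j.+1 T = 0.
Proof. exact: tail_integral_end. Qed.

(** As [psi] is merely integrable, differentiability at [t] is an assumption here, to be supplied at
    almost every point or at continuity points. The higher levels integrate continuous functions and
    are differentiable throughout the open interval. *)
Lemma is_derive_iterated_psi0 t :
  is_derive t (1 : R) (tail_integral T psi) (- psi t) ->
  is_derive t (1 : R) (m 0) (- psi t).
Proof.
move=> d; rewrite -[X in is_derive _ _ _ X]addr0.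
exact: (is_deriveD d (is_derive_cst c t 1)).
Qed.

Lemma is_derive_iterated_psiS j t : 0 < t < T ->
  is_derive t (1 : R) (m j.+1) (- m j t).
Proof.
move=> t0T; apply: is_derive_tail_integral (iterated_psi_integrable j) (t0T) _.
have /(continuous_within_itvP _ T_gt0)[mc _ _] := iterated_psi_continuous (j := j).
by apply: mc; rewrite in_itv/=.
Qed.

Lemma near_itvoo (P : R -> Prop) t : 0 < t < T -> (forall s, 0 < s < T -> P s) ->
  \forall s \near t, P s.
Proof.
move=> /andP[t0 tT] PT; near=> s; apply: PT; apply/andP; split.
- by near: s; exact: lt_nbhsr.
- by near: s; exact: lt_nbhsl.
Unshelve. all: by end_near. Qed.

(** Each derivative lowers the level by one and changes the sign. Agreement is asked for on the open
    interval only, because the co-states are controlled only inside [[0, T]]; there it holds on a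
    neighbourhood of each point, which is enough for derivatives. *)
Lemma derive1n_iterated_psi (g : R -> R) i j s :
  (forall r, 0 < r < T -> g r = m (i + j) r) -> 0 < s < T ->
  derive1n i g s = (-1) ^+ i * m j s.
Proof.
elim: i j s => [|i IH] j s gm sT; first by rewrite expr0 mul1r -gm.
have {}IH r : 0 < r < T -> derive1n i g r = (-1) ^+ i * m j.+1 r.
  by apply: IH => q qT; rewrite gm// addnS.
rewrite derive1nS derive1E (near_eq_derive _ (near_itvoo sT IH)).
have d := is_derive_iterated_psiS j sT.
rewrite (deriveZ ((-1) ^+ i) (@ex_derive _ _ _ _ _ _ _ d)).
rewrite (@derive_val _ _ _ _ _ _ _ d).
by rewrite exprS mulN1r mulNr -mulrN.
Qed.

(** The first [j] derivatives exist on the whole open interval and lead down to [m 0]; only the last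
    one meets [psi]. Hence the exceptional null set does not depend on [j]. *)
Lemma is_nth_derive_iterated_psi (g : R -> R) j t :
  (forall r, 0 < r < T -> g r = m j r) -> 0 < t < T ->
  is_derive t (1 : R) (m 0) (- psi t) ->
  is_nth_derive j.+1 g t ((-1) ^+ j.+1 * psi t).
Proof.
move=> gm tT d0.
have gi i : (i <= j)%N -> \forall s \near t, (-1) ^+ i * m (j - i) s = derive1n i g s.
  move=> ij; apply: (near_itvoo tT) => s sT.
  by rewrite (@derive1n_iterated_psi _ _ (j - i)%N)// subnKC.
have dm i : derivable (m i) t 1.
  by case: i => [|i]; [exact: ex_derive|have := is_derive_iterated_psiS i tT => d; exact: ex_derive].
split=> [i|].
  rewrite ltnS => /gi /near_eq_derivable; apply.
  exact: derivableZ.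
rewrite derive1nS derive1E -(near_eq_derive _ (gi _ (leqnn j))) subnn.
rewrite (deriveZ ((-1) ^+ j) (dm _)) (@derive_val _ _ _ _ _ _ _ d0).
by rewrite exprS mulN1r mulNr -mulrN.
Qed.

(* Repeated integration by parts; the boundary terms at T vanish except for c * k T. *)
Lemma adjoint_expansion (k : R -> R) t n : 0 <= t <= T ->
  (forall i s, 0 <= s <= T -> derivable (derive1n i k) s 1) ->
  \int[mu]_(s in `[t, T]) (psi s * k s) + c * k T =
  \sum_(i < n.+1) m i t * derive1n i k t +
  \int[mu]_(s in `[t, T]) (m n s * derive1n n.+1 k s).
Proof.
move=> /andP[t0 tT] dk.
have dkt i s : t <= s <= T -> derivable (derive1n i k) s 1.
  by move=> /andP[ts sT]; apply: dk; rewrite sT (le_trans t0).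
have ck i : {within `[t, T], continuous (derive1n i k)}.
  by apply: derivable_within_continuous => s; rewrite in_itv/=; exact: dkt.
have it h : mu.-integrable `[0, T] (EFin \o h) -> mu.-integrable `[t, T] (EFin \o h).
  exact: integrable_subitv.
elim: n => [|n IH].
  rewrite big_ord1 (tail_integral_by_parts tT (it _ psi_int) (dkt 0%N) (ck 1%N)).
  rewrite derive1n0 derive1n1 -/(tail_integral T psi t).
  (* Since [m 0] is the tail integral plus [c], the constant contributes [c * (k T - k t)]: the part
     at [t] completes the boundary term to [m 0 t * k t], the part at [T] is the extra term on the
     left. *)
  have -> : \int[mu]_(s in `[t, T]) (m 0 s * derive1 k s) =
      \int[mu]_(s in `[t, T]) (tail_integral T psi s * derive1 k s) + c * (k T - k t).
    rewrite -(Rintegral_derive1 tT (dkt 0%N) (ck 1%N)).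
    have k'i : mu.-integrable `[t, T] (EFin \o derive1 k).
      by apply: continuous_compact_integrable (ck 1%N); exact: segment_compact.
    rewrite -RintegralZl// -RintegralD//.
    - by apply: eq_Rintegral => s _; rewrite -mulrDl.
    - apply: integrable_mul_continuous (ck 1%N).
      apply: continuous_compact_integrable; first exact: segment_compact.
      exact: tail_integral_continuous tT (it _ psi_int).
    - apply: integrable_mul_continuous (ck 1%N).
      apply: continuous_compact_integrable; first exact: segment_compact.
      by move=> s; exact: cvg_cst.
  by rewrite /= -/(tail_integral T psi t) -/c; ring.
rewrite IH [in RHS]big_ord_recr/= -[in RHS]addrA; congr (_ + _).
exact: tail_integral_by_parts tT (it _ (iterated_psi_integrable n)) (dkt n.+1) (ck n.+2).
Qed.

(** * Integration against the Taylor powers *)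

Let pow t n (s : R) : R := (s - t) ^+ n / n`!%:R.

Lemma is_derive_pow t n s : is_derive s (1 : R) (pow t n.+1) (pow t n s).
Proof.
have d : is_derive s (1 : R) (fun s => s - t) 1 by exact: is_derive_shift.
have := is_deriveZ ((n.+1)`!%:R^-1 : R) (is_deriveX n.+1 d).
rewrite (_ : _ \*: _ = pow t n.+1); last first.
  by apply/funext => r; rewrite /pow exprfctE mulrC.
rewrite (_ : _ *: _ = pow t n s)//.
rewrite /GRing.scale/= mulr1 /pow factS natrM invfM mulrACA mulVf ?mul1r 1?mulrC//.
Qed.

Lemma derivable_pow t n s : derivable (pow t n) s 1.
Proof.
case: n => [|n]; last by have d := is_derive_pow t n s; exact: ex_derive.
by rewrite (_ : pow t 0 = cst (1 / 1%:R)).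
Qed.

Lemma derive1_pow t n : derive1 (pow t n.+1) = pow t n.
Proof.
apply/funext => s; rewrite derive1E.
by have d := is_derive_pow t n s; rewrite derive_val.
Qed.

Lemma pow_continuous t n : {within `[t, T], continuous (pow t n)}.
Proof. by apply: derivable_within_continuous => s _; exact: derivable_pow. Qed.

(** Each integration by parts trades one tail integration for one more power. The boundary term at
    [s = t] vanishes because the raised power has positive exponent. *)
Lemma iterated_psi_pow t j n : 0 <= t <= T ->
  \int[mu]_(s in `[t, T]) (m j s * pow t n s) =
  \int[mu]_(s in `[t, T]) (m 0 s * pow t (n + j) s).
Proof.
move=> /andP[t0 tT].
elim: j n => [|j IH] n; first by rewrite addn0.
rewrite addnS -addSn -IH.
rewrite (tail_integral_by_parts tT (integrable_subitv t0 (lexx T) (iterated_psi_integrable j)) (fun s _ => @derivable_pow t n.+1 s))//.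
- by rewrite derive1_pow /pow subrr expr0n/= mul0r mulr0 add0r.
- by rewrite derive1_pow; exact: pow_continuous.
Qed.

Lemma iterated_psiSE t j : 0 <= t <= T ->
  m j.+1 t = \int[mu]_(s in `[t, T])
    ((s - t) ^+ j.+1 / (j.+1)`!%:R * psi s + (s - t) ^+ j / j`!%:R * c).
Proof.
move=> tT; have /andP[t0 tT'] := tT.
have psit := integrable_subitv t0 (lexx T) psi_int.
have -> : m j.+1 t = \int[mu]_(s in `[t, T]) (m j s * pow t 0 s).
  by apply: eq_Rintegral => s _; rewrite /pow expr0 fact0 divr1 mulr1.
rewrite iterated_psi_pow// add0n.
have pi n : mu.-integrable `[t, T] (EFin \o pow t n).
  by apply: continuous_compact_integrable; [exact: segment_compact|exact: pow_continuous].
have ci : {within `[t, T], continuous (fun=> c)} by move=> s; exact: cvg_cst.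
transitivity (\int[mu]_(s in `[t, T]) (psi s * pow t j.+1 s + pow t j s * c)); last first.
  by apply: eq_Rintegral => s _; rewrite mulrC.
rewrite RintegralD//; last 2 first.
- exact: integrable_mul_continuous psit (@pow_continuous t _).
- exact: integrable_mul_continuous (pi j) ci.
(* One more integration by parts turns [psi] against power [j.+1] into its tail integral against
   power [j]; together with the [c] term this is [m 0] against [pow t j]. *)
rewrite (tail_integral_by_parts tT' psit (fun s _ => @derivable_pow t j.+1 s))//; last first.
  by rewrite derive1_pow; exact: pow_continuous.
rewrite derive1_pow /pow subrr expr0n/= mul0r mulr0 add0r -/(pow t j).
rewrite -RintegralD//.
- by apply: eq_Rintegral => s _; rewrite /= [_ * c]mulrC -mulrDl.
- apply: integrable_mul_continuous (@pow_continuous t _).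
  apply: continuous_compact_integrable; first exact: segment_compact.
  exact: tail_integral_continuous tT' psit.
- exact: integrable_mul_continuous (pi j) ci.
Qed.

End IteratedPsi.

(** * The iterated tail integrals solve the Hamiltonian system *)

Section Hamiltonian.
Context {R : realType} {U : Type}.
Variables (T : R) (x0 : R -> R) (K : set U).
Variables (f : R -> R -> R -> U -> R) (F : R -> R -> U -> R) (F0 : R -> R).
Variables (u : R -> U) (x : R -> linf R) (psi : R -> R).
Hypotheses (T_gt0 : 0 < T) (smooth : smooth_data T K f F F0)
  (u_K : forall t : R, 0 <= t <= T -> K (u t))
  (psi_adj : is_adjoint T x0 f F F0 u x psi)
  (vanish : forall t : R, 0 <= t <= T -> remainder T x0 f F0 u x psi n t @[n --> \oo] --> 0).
Local Notation mu := (@lebesgue_measure R).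
Local Notation m := (iterated_psi T x0 F0 x psi).

Let terms t i := m i t * dtime i (dstate f) t t (state x0 x t) (u t).

Lemma costate_series_cvg (t : R) : 0 <= t <= T ->
  series (terms t) @ \oo --> psi t - derive1 (fun z => F t z (u t)) (state x0 x t).
Proof.
move=> tT; have [psi_int psiE] := psi_adj; have [dtf _ _] := smooth.
have dk n s : 0 <= s <= T ->
    derivable (derive1n n (fun r => dstate f r t (state x0 x t) (u t))) s 1.
  by move=> sT; have [] := dtf n s t (state x0 x t) (u t) sT tT (u_K tT).
(* The expansion of order [n] has [n.+1] terms, so remainder [n] goes with partial sum [n.+1]; the
   limit is therefore taken along the shifted series. *)
have E n : series (terms t) n.+1 =
    psi t - derive1 (fun z => F t z (u t)) (state x0 x t) -
    remainder T x0 f F0 u x psi n t.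
  have := @adjoint_expansion _ _ x0 F0 x _ T_gt0 psi_int _ _ n tT dk.
  rewrite psiE// /series/= big_mkord => H.
  apply/eqP; rewrite eq_sym subr_eq -H; apply/eqP.
  ring.
rewrite -cvg_shiftS; under eq_fun do rewrite E.
have := cvgB (cvg_cst (psi t - derive1 (fun z => F t z (u t)) (state x0 x t)))
  (vanish tT).
by rewrite subr0; apply.
Qed.

(** The two endpoints form a null set. The system is stated on the closed interval, whereas
    derivatives of tail integrals are available only inside. *)
Lemma ae_itvcc (P : R -> Prop) :
  {ae mu, forall t : R, 0 < t < T -> P t} -> {ae mu, forall t : R, 0 <= t <= T -> P t}.
Proof.
have n1 (a : R) : {ae mu, forall t : R, t != a}.
  exists [set a]; split => //; first exact: lebesgue_measure_set1.
  by move=> t /= /negP/negPn/eqP.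
move=> PT; have := n1 0; have := n1 T; move: PT.
apply: filterS3; first exact: (ae_filter_ringOfSetsType mu).
move=> t PT tT t0 /andP[t0' tT']; apply: PT.
by rewrite !lt_neqAle t0' tT' tT eq_sym t0.
Qed.

Lemma iterated_psi_hamiltonian : hamiltonian_solution T x0 f F F0 u x m.
Proof.
have [psi_int psiE] := psi_adj.
split.
- by move=> j; exact: absolutely_continuous_iterated_psi.
- by move=> t tT; apply/cvg_ex; eexists; exact: costate_series_cvg.
- apply: ae_itvcc.
  have := ae_is_derive_tail_integral psi_int.
  apply: filterS; first exact: (ae_filter_ringOfSetsType mu).
  move=> t d tT; have tT' : 0 <= t <= T by have /andP[? ?] := tT; rewrite !ltW.
  (* The series sums to [psi t] minus the state derivative of [F], so the right-hand side collapses
     to [- psi t]. *)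
  rewrite (cvg_lim _ (costate_series_cvg tT'))// subrK.
  by apply: is_derive_iterated_psi0; exact: d.
- move=> j; apply: ae_itvcc; apply: aeW => t tT.
  exact: is_derive_iterated_psiS.
- by split=> [|j]; [exact: iterated_psi0_end|exact: iterated_psiS_end].
Qed.

End Hamiltonian.

(** * Identification of the co-states and recovery of [psi] *)

Theorem mainTheorem6 (R : realType) (U : Type) (T : R) (x0 : R -> R)
    (K : set U) (Uad : set (R -> U))
    (f : R -> R -> R -> U -> R) (F : R -> R -> U -> R) (F0 : R -> R)
    (T_gt0 : 0 < T)
    (Uad_K : forall u, Uad u -> forall t : R, 0 <= t <= T -> K (u t))
    (smooth : smooth_data T K f F F0)
    (X : (R -> U) -> R -> linf R) (psi : (R -> U) -> R -> R)
    (X_traj : forall u, Uad u -> is_trajectory T x0 f u (X u))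
    (psi_adj : forall u, Uad u -> is_adjoint T x0 f F F0 u (X u) (psi u))
    (vanish : remainders_vanish T x0 Uad f F0 X psi)
    (V : R * linf R -> R) (V_hjb : hjb_solution T x0 K f F F0 V)
    (u : R -> U) (u_adm : Uad u) (lam : nat -> R -> R)
    (lam_costate : forall j (t : R), 0 <= t <= T -> lam j t = dxV V j t (X u t))
    (lam_ham : hamiltonian_solution T x0 f F F0 u (X u) lam)
    (lam_uniq : forall lam', hamiltonian_solution T x0 f F F0 u (X u) lam' ->
      forall j (t : R), 0 <= t <= T -> lam' j t = lam j t) :
  let mu := @lebesgue_measure R in
  let c := derive1 F0 (state x0 (X u) T) in
  [/\ (forall t : R, 0 <= t <= T ->
        lam 0%N t = \int[mu]_(s in `[t, T]) psi u s + c),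
      (forall j (t : R), 0 <= t <= T ->
        lam j.+1 t = \int[mu]_(s in `[t, T])
          ((s - t) ^+ j.+1 / (j.+1)`!%:R * psi u s
           + (s - t) ^+ j / j`!%:R * c)),
      lam 0%N T = c /\ lam 0%N t @[t --> T^'-] --> c,
      (forall j, {ae mu, forall t : R, 0 < t < T ->
        is_nth_derive j.+1 (lam j) t ((-1) ^+ j.+1 * psi u t)}) &
      (forall j (t : R), 0 < t < T -> {for t, continuous (psi u)} ->
        is_nth_derive j.+1 (lam j) t ((-1) ^+ j.+1 * psi u t))].
Proof.
move=> mu c; have [psi_int psiE] := psi_adj u u_adm.
pose m := iterated_psi T x0 F0 (X u) (psi u).
have lamE j t : 0 <= t <= T -> lam j t = m j t.
  move=> tT; apply/esym; apply: lam_uniq tT.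
  apply: iterated_psi_hamiltonian smooth _ (psi_adj u u_adm) _ => //.
    exact: Uad_K.
  (* The uniform decay of the remainders is specialised to the control [u] and the time [s]. *)
  move=> s sT; apply/cvgrPdist_le => e e0.
  have := vanish e e0; apply: filterS => n /(_ u s u_adm sT).
  by rewrite sub0r normrN.
have lamE' j t : 0 < t < T -> lam j t = m j t.
  by move=> /andP[t0 tT]; rewrite lamE// !ltW.
split.
- by move=> t tT; rewrite lamE.
- by move=> j t tT; rewrite lamE//; exact: iterated_psiSE.
- have cT : lam 0%N T = c by rewrite lamE ?lexx ?ltW//; exact: iterated_psi0_end.
  split=> //; rewrite -cT lamE ?lexx ?ltW//.
  (* The left limit at [T] is that of the continuous function [m 0], which equals [lam 0] just below
     [T]. *)
  have /(continuous_within_itvP _ T_gt0)[_ _] :=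
    @iterated_psi_continuous _ T x0 F0 (X u) _ T_gt0 psi_int 0.
  apply: cvg_trans; apply: near_eq_cvg; near=> t; rewrite [RHS]lamE'//.
  apply/andP; split; near: t; [exact: nbhs_left_gt|exact: nbhs_left_lt].
- move=> j; have := ae_is_derive_tail_integral psi_int.
  apply: filterS; first exact: (ae_filter_ringOfSetsType (@lebesgue_measure R)).
  move=> t d tT; have d0 := is_derive_iterated_psi0 x0 F0 (X u) (d tT).
  exact (is_nth_derive_iterated_psi T_gt0 psi_int (lamE' j) tT d0).
- move=> j t tT ct; have d := is_derive_tail_integral psi_int tT ct.
  have d0 := is_derive_iterated_psi0 x0 F0 (X u) d.
  exact (is_nth_derive_iterated_psi T_gt0 psi_int (lamE' j) tT d0).
Unshelve. all: by end_near. Qed.
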